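(* Let $L=L(\mathsf X,\mathsf U,\mathcal F)$ and assume the uniform mixing condition with constant $\tau$. Let $\widehat{\boldsymbol\gamma}$ be the exponential weights behavioral strategy with learning rate $\rho=\sqrt{\frac{2TL^2}{\log|\mathsf U|}}$ (where $|\mathsf U|\ge2$ and $L>0$, so that $\rho\in(0,\infty)$). Then for every initial state $x\in\mathsf X$ and every oblivious sequence $\boldsymbol f=(f_1,\dots,f_T)\in\mathcal F^T$, $$\mathbb E_x^{\widehat{\boldsymbol\gamma},\boldsymbol f}\Big[\sum_{t=1}^Tf_t(X_t,U_t)-\Psi(\boldsymbol f)\Big]\le2L\sqrt{2T\log|\mathsf U|}+C_{\mathcal F}(\tau+1)^2\sqrt{\frac{T\log|\mathsf U|}{2}}+(2\tau+2)C_{\mathcal F},$$ where $C_{\mathcal F}=\sup_{f\in\mathcal F}\|f\|_\infty$.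
   Context: $\mathsf X,\mathsf U$ are finite nonempty sets (states, actions); $K(y|x,u)$ is a fixed transition kernel; $\mathcal P(\cdot)$ denotes the set of probability distributions on a finite set; $\mathcal M(\mathsf U|\mathsf X)$ is the set of Markov matrices $P=[P(u|x)]$, $P(\cdot|x)\in\mathcal P(\mathsf U)$; $K(y|x,P)=\sum_uK(y|x,u)P(u|x)$, and $\mu K(\cdot|P)$ denotes the distribution $y\mapsto\sum_x\mu(x)K(y|x,P)$. $\|\cdot\|_1$ is the $\ell_1$ norm; $\log$ is natural; $(\pi\otimes P)(x,u)=\pi(x)P(u|x)$; $\langle\nu,f\rangle$ is the expectation of $f$ under $\nu$. Uniform mixing condition: there is a finite constant $\tau\ge1$ such that $\|\mu_1K(\cdot|P)-\mu_2K(\cdot|P)\|_1\le e^{-1/\tau}\|\mu_1-\mu_2\|_1$ for all $P\in\mathcal M(\mathsf U|\mathsf X)$ and $\mu_1,\mu_2\in\mathcal P(\mathsf X)$. In particular each $K(\cdot|\cdot,P)$ has a unique invariant distribution $\pi_P$. $\mathcal F$ is a fixed nonempty uniformly bounded class of functions $\mathsf X\times\mathsf U\to\mathbb R$; $T\ge1$ is a fixed horizon. $\widehat Q:\mathsf X\times\mathsf U\to\mathbb R$ satisfies the reverse Poisson inequality for $P$ with forcing function $g$ if for all $(x,u)$ $$\sum_yK(y|x,u)\widehat Q(y,P)-\widehat Q(x,u)\ge -g(x,u)+\langle\pi_P\otimes P,g\rangle,\qquad \widehat Q(y,P)=\sum_{u'}P(u'|y)\widehat Q(y,u').$$ Standing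 assumption: for every $P\in\mathcal M(\mathsf U|\mathsf X)$ and $f\in\mathcal F$ there is a (fixed choice of) function $\widehat Q_{P,f}$ satisfying the reverse Poisson inequality for $P$ with forcing function $f$, and $L(\mathsf X,\mathsf U,\mathcal F)=\sup_{P}\sup_{f\in\mathcal F}\|\widehat Q_{P,f}\|_\infty<\infty$. Game: $X_1=x$. For $t=1,\dots,T$: the agent, using a state feedback law $P_t\in\mathcal M(\mathsf U|\mathsf X)$ depending only on $f_1,\dots,f_{t-1}$, observes $X_t$ and draws $U_t\sim P_t(\cdot|X_t)$; $f_t$ is revealed; the cost $f_t(X_t,U_t)$ is incurred; $X_{t+1}\sim K(\cdot|X_t,U_t)$. The sequence $\boldsymbol f$ is oblivious: it does not depend on states or actions. The comparator is $\Psi(\boldsymbol f)=\inf_{P\in\mathcal M(\mathsf U|\mathsf X)}\sum_{t=1}^T\langle\pi_P\otimes P,f_t\rangle$. Exponential weights strategy with learning rate $\rho>0$: for all $y\in\mathsf X$, $P_1(\cdot|y)=\nu_1$, the uniform distribution on $\mathsf U$; after $f_t$ is revealed, set $h_{y,t}=\widehat Q_{P_t,f_t}(y,\cdot)$ for all $y\in\mathsf X$ and $$P_{t+1}(u|y)=\frac{\exp(-\frac1\rho\sum_{s=1}^th_{y,s}(u))}{\sum_{v\in\mathsf U}\exp(-\frac1\rho\sum_{s=1}^th_{y,s}(v))}.$$ *)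

(* Defs.v *)
From HB Require Import structures.
From mathcomp Require Import all_boot all_order all_algebra.
From mathcomp Require Import all_classical all_reals all_analysis.
Set Implicit Arguments.
Unset Strict Implicit.
Unset Printing Implicit Defensive.
Import Order.TTheory GRing.Theory Num.Theory.
Local Open Scope classical_set_scope.
Local Open Scope ring_scope.

(* Conventions: [K x u y] is K(y|x,u); [P x u] is P(u|x); rounds are numbered
   from 0, so that round [t] here is round t+1 of the game. *)

Definition is_dist (R : realType) (T : finType) (mu : T -> R) : Prop :=
  (forall z, 0 <= mu z) /\ \sum_z mu z = 1.

Definition dirac_dist (R : realType) (T : finType) (a : T) : T -> R :=
  fun z => (z == a)%:R.

Definition uniform_dist (R : realType) (T : finType) : T -> R :=
  fun _ => #|T|%:R^-1.

Definition l1_norm (R : realType) (T : finType) (g : T -> R) : R :=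
  \sum_z `|g z|.

Definition sup_norm (R : realType) (X U : finType) (g : X -> U -> R) : R :=
  \big[Num.max/0]_(z : X * U) `|g z.1 z.2|.

Definition is_trans_kernel (R : realType) (X U : finType) (K : X -> U -> X -> R) :
    Prop :=
  forall x u, is_dist (K x u).

Definition markov_mx (R : realType) (X U : finType) : set (X -> U -> R) :=
  [set P | forall x, is_dist (P x)].

Definition kernel_of (R : realType) (X U : finType) (K : X -> U -> X -> R)
    (P : X -> U -> R) (x y : X) : R :=
  \sum_u K x u y * P x u.

Definition push (R : realType) (X U : finType) (K : X -> U -> X -> R)
    (mu : X -> R) (P : X -> U -> R) (y : X) : R :=
  \sum_x mu x * kernel_of K P x y.

Definition uniform_mixing (R : realType) (X U : finType)
    (K : X -> U -> X -> R) (tau : R) : Prop :=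
  1 <= tau /\
  forall (P : X -> U -> R) (mu1 mu2 : X -> R),
    markov_mx P -> is_dist mu1 -> is_dist mu2 ->
    l1_norm (fun y => push K mu1 P y - push K mu2 P y)
      <= expR (- tau^-1) * l1_norm (fun x => mu1 x - mu2 x).

Definition invariant_dist (R : realType) (X U : finType)
    (K : X -> U -> X -> R) (P : X -> U -> R) (mu : X -> R) : Prop :=
  is_dist mu /\ push K mu P = mu.

(* Selected by choice among the invariant distributions; it is the unique one
   for every Markov matrix [P] under [uniform_mixing].  The default value is
   only used when no invariant distribution exists. *)
Definition inv_dist (R : realType) (X U : finType) (K : X -> U -> X -> R)
    (P : X -> U -> R) : X -> R :=
  xget (@uniform_dist R X) [set mu | invariant_dist K P mu].

Definition otimes (R : realType) (X U : finType) (mu : X -> R)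
    (P : X -> U -> R) : X -> U -> R :=
  fun x u => mu x * P x u.

Definition pairing (R : realType) (X U : finType) (nu g : X -> U -> R) : R :=
  \sum_x \sum_u nu x u * g x u.

Definition reverse_Poisson (R : realType) (X U : finType)
    (K : X -> U -> X -> R) (P g Q : X -> U -> R) : Prop :=
  forall x u,
    \sum_y K x u y * (\sum_u' P y u' * Q y u') - Q x u
      >= - g x u + pairing (otimes (inv_dist K P) P) g.

Definition uniformly_bounded (R : realType) (X U : finType)
    (F : set (X -> U -> R)) : Prop :=
  exists B : R, forall f, F f -> forall x u, `|f x u| <= B.

Definition cost_sup (R : realType) (X U : finType) (F : set (X -> U -> R)) :
    \bar R :=
  ereal_sup [set (sup_norm f)%:E | f in F].

Definition Q_sup (R : realType) (X U : finType) (F : set (X -> U -> R))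
    (Q : (X -> U -> R) -> (X -> U -> R) -> X -> U -> R) : \bar R :=
  ereal_sup [set ereal_sup [set (sup_norm (Q P f))%:E | f in F]
            | P in @markov_mx R X U].

Definition comparator (R : realType) (X U : finType) (K : X -> U -> X -> R)
    (fs : seq (X -> U -> R)) : R :=
  inf [set \sum_(f <- fs) pairing (otimes (inv_dist K P) P) f
      | P in @markov_mx R X U].

(* A strategy maps the cost functions revealed so far, oldest first, to the
   state feedback law used in the next round. *)
Definition strategy (R : realType) (X U : finType) : Type :=
  seq (X -> U -> R) -> X -> U -> R.

(* Probability that the state-action pairs of the first [size w] rounds are [w],
   when the first state has law [mu] and the law [P t] is used in round [t]. *)
Fixpoint traj_prob (R : realType) (X U : finType) (K : X -> U -> X -> R)
    (P : nat -> X -> U -> R) (mu : X -> R) (w : seq (X * U)) : R :=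
  match w with
  | [::] => 1
  | (y, u) :: w' =>
      mu y * P 0%N y u * traj_prob K (fun t => P t.+1) (K y u) w'
  end.

Definition game_expectation (R : realType) (X U : finType)
    (K : X -> U -> X -> R) (gamma : strategy R X U) (T : nat)
    (f : T.-tuple (X -> U -> R)) (x : X) (Z : T.-tuple (X * U) -> R) : R :=
  \sum_(w : T.-tuple (X * U))
     traj_prob K (fun t => gamma (take t f)) (@dirac_dist R X x) w * Z w.

Definition gibbs (R : realType) (X U : finType) (rho : R) (H : X -> U -> R) :
    X -> U -> R :=
  fun y u => expR (- rho^-1 * H y u) / \sum_v expR (- rho^-1 * H y v).

(* The second component is the running sum of the functions Q_{P_s,f_s}. *)
Definition exp_weights_state (R : realType) (X U : finType)
    (Q : (X -> U -> R) -> (X -> U -> R) -> X -> U -> R) (rho : R)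
    (fs : seq (X -> U -> R)) : (X -> U -> R) * (X -> U -> R) :=
  foldl (fun (S : (X -> U -> R) * (X -> U -> R)) f =>
           let H := fun y u => S.2 y u + Q S.1 f y u in (gibbs rho H, H))
        ((fun _ => @uniform_dist R U), (fun _ _ => 0)) fs.

Definition exp_weights (R : realType) (X U : finType)
    (Q : (X -> U -> R) -> (X -> U -> R) -> X -> U -> R) (rho : R) :
    strategy R X U :=
  fun fs => (exp_weights_state Q rho fs).1.

(* Main.v *)
Require Import Defs.
From HB Require Import structures.
From mathcomp Require Import all_boot all_order all_algebra.
From mathcomp Require Import all_classical all_reals all_analysis.
From mathcomp Require Import ring lra.
Import Order.TTheory GRing.Theory Num.Theory.
Set Implicit Arguments.
Unset Strict Implicit.
Unset Printing Implicit Defensive.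
Local Open Scope classical_set_scope.
Local Open Scope ring_scope.

(* Write mu_t for the law of X_t, pi_t for the invariant law of P_t and
   d = L / rho.  Two consecutive Gibbs laws differ by likelihood ratios in
   [e^-d, e^d] up to normalisation, hence by at most 2 tanh (d / 2) <= d in l1.
   Mixing contracts by e^(-1/tau) <= tau / (tau + 1), so invariant laws drift by
   at most (tau + 1) d per round and mu_t tracks pi_t with total error
   (tau + 1) (2 + T (tau + 1) d).  The remaining steady-state regret against a
   fixed P is, by the reverse Poisson inequality averaged over pi_P (x) P, at
   most the pi_P-average of the exponential weights regrets at each state.  Each
   of these is at most rho log |U| + T L d: the law P_{t+1}, which looks one
   round ahead, has regret at most rho log |U|, and replacing P_{t+1} by P_t
   costs L d per round. *)

(** * The l1 effect of a bounded exponential tilt *)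

(** The inequality tanh (a / 2) <= a / 2 without denominators. The difference [g] of the two sides
    vanishes at 0 and is nondecreasing, because (1 - x) e^x <= 1. *)
Lemma tanh_half_le (R : realType) (a : R) : 0 <= a ->
  2 * (expR a - 1) <= a * (expR a + 1).
Proof.
move=> a0; pose g (x : R) : R := x * (expR x + 1) - 2 * (expR x - 1).
have dg (x : R) : is_derive x 1 g (1 + (x - 1) * expR x).
  by apply: is_derive_eq; rewrite /GRing.scale /=; ring.
suff : g 0 <= g a by rewrite /g expR0; lra.
apply: (@ger0_derive1_le_cc _ g 0 a) => //.
- move=> x _; rewrite derive1E derive_val.
  have := expR_ge1Dx (- x); rewrite expRN => hx.
  have ex : 0 < expR x := expR_gt0 x.
  have : (1 - x) * expR x <= 1 by rewrite -ler_pdivlMr// mul1r.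
  by lra.
- apply: derivable_within_continuous => x _; exact: ex_derive.
- by rewrite in_itv /= lexx a0.
- by rewrite in_itv /= lexx a0.
Qed.

(** Equal masses balance the positive and negative parts of [p - q], so each part carries half of
    the l1 distance. *)
Lemma sum_abs_subr_dist (R : realType) (I : finType) (p q : I -> R) :
  \sum_i p i = \sum_i q i ->
  \sum_i `|p i - q i| = 2 * \sum_(i | q i < p i) (p i - q i).
Proof.
move=> epq.
have s0 : \sum_i (p i - q i) = 0 by rewrite sumrB epq subrr.
rewrite (bigID (fun i => q i < p i)) /= in s0.
rewrite (bigID (fun i => q i < p i)) /=.
rewrite (eq_bigr (fun i => p i - q i)); last first.
  by move=> i hi; rewrite gtr0_norm// subr_gt0.
rewrite [X in _ + X](eq_bigr (fun i => - (p i - q i))); last first.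
  by move=> i hi; rewrite ler0_norm// subr_le0 leNgt.
by rewrite sumrN; lra.
Qed.

(* An event of probability [a] has weight [WA] and its complement weight [WB]
   after tilting by factors in [1/E, E]; the inequality says that
   [a - WA / (WA + WB) <= tanh (ln E / 2)].  The extremal case reduces to
   [0 <= (a - (1 - a) E)^2]. *)
Lemma tilted_event_le (R : realType) (a E WA WB : R) :
  1 <= E -> 0 <= a <= 1 -> a / E <= WA -> 0 <= WB -> WB <= (1 - a) * E ->
  (E + 1) * (a * WB - (1 - a) * WA) <= (E - 1) * (WA + WB).
Proof.
move=> E1 /andP[a0 a1] hA hB0 hB.
have E0 : 0 < E by lra.
(* The claim is linear in [WA] and [WB], with a favourable coefficient of [WA]; the split is on the
   sign of that of [WB]. If it is unfavourable, both weights are moved to their extreme values. *)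
have [h|h] := leP ((E + 1) * a) (E - 1).
  have WA0 : 0 <= WA by apply: le_trans hA; apply: divr_ge0; lra.
  have h1 : 0 <= WB * ((E - 1) - (E + 1) * a) by apply: mulr_ge0; lra.
  have h2 : 0 <= WA * ((E - 1) + (E + 1) * (1 - a)).
    by apply: mulr_ge0 => //; apply: addr_ge0; [lra|apply: mulr_ge0; lra].
  by move: h1 h2; lra.
have h1 : 0 <= ((1 - a) * E - WB) * ((E + 1) * a - (E - 1)).
  by apply: mulr_ge0; lra.
have h2 : 0 <= (WA - a / E) * ((E - 1) + (E + 1) * (1 - a)).
  apply: mulr_ge0; first lra.
  by apply: addr_ge0; [lra|apply: mulr_ge0; lra].
have h3 : 0 <= (E - 1) / E * (a - (1 - a) * E) ^+ 2.
  by apply: mulr_ge0; rewrite ?sqr_ge0//; apply: divr_ge0; lra.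
have eq3 : (E - 1) / E * (a - (1 - a) * E) ^+ 2 =
  a / E * ((E - 1) + (E + 1) * (1 - a)) - (1 - a) * E * ((E + 1) * a - (E - 1)).
  by field; lra.
by rewrite eq3 in h3; move: h1 h2 h3; lra.
Qed.

(** The event [q < p] carries half of the distance, and [tilted_event_le] with E = e^b bounds that
    half by tanh (b / 2) <= b / 2. *)
Lemma l1_tilt_le (R : realType) (I : finType) (p w q : I -> R) (b : R) :
  is_dist p -> 0 <= b -> (forall i, expR (- b) <= w i <= expR b) ->
  (forall i, q i = p i * w i / \sum_j p j * w j) ->
  \sum_i `|p i - q i| <= b.
Proof.
move=> [p0 p1] b0 hw hq.
set W := \sum_j p j * w j in hq.
have w0 i : 0 <= w i.
  by case/andP: (hw i) => h _; apply: le_trans h; exact: expR_ge0.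
have W0 : 0 < W.
  apply: (@lt_le_trans _ _ (expR (- b))); first exact: expR_gt0.
  rewrite -[leLHS]mul1r -p1 mulr_suml; apply: ler_sum => i _.
  by apply: ler_wpM2l => //; case/andP: (hw i).
have q1 : \sum_i q i = 1.
  by rewrite (eq_bigr _ (fun i _ => hq i)) -mulr_suml divff// gt_eqF.
rewrite sum_abs_subr_dist ?p1 ?q1//.
set A := (fun i => q i < p i).
set pA := \sum_(i | A i) p i.
set WA := \sum_(i | A i) p i * w i; set WB := \sum_(i | ~~ A i) p i * w i.
have eW : W = WA + WB by rewrite /W (bigID A).
have epB : \sum_(i | ~~ A i) p i = 1 - pA.
  by apply/eqP; rewrite eq_sym subr_eq addrC -p1 (bigID A).
have := @tilted_event_le R pA (expR b) WA WB.
have -> : \sum_(i | A i) (p i - q i) = pA - WA / W.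
  by rewrite sumrB (eq_bigr _ (fun i _ => hq i)) -mulr_suml.
have E1 : 1 <= expR b by rewrite -expR0 ler_expR.
have pA0 : 0 <= pA by apply: sumr_ge0.
have pB0 : 0 <= 1 - pA by rewrite -epB; apply: sumr_ge0.
have hA : pA / expR b <= WA.
  rewrite -expRN mulr_suml; apply: ler_sum => i _.
  by apply: ler_wpM2l => //; case/andP: (hw i).
have hB0 : 0 <= WB by apply: sumr_ge0 => i _; apply: mulr_ge0.
have hB : WB <= (1 - pA) * expR b.
  rewrite -epB mulr_suml; apply: ler_sum => i _.
  by apply: ler_wpM2l => //; case/andP: (hw i).
move=> /(_ E1 _ hA hB0 hB) H.
have {}H : (expR b + 1) * (pA * WB - (1 - pA) * WA) <= (expR b - 1) * W.
  by rewrite eW; apply: H; apply/andP; split => //; lra.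
have -> : pA - WA / W = (pA * WB - (1 - pA) * WA) / W.
  by apply: (mulIf (lt0r_neq0 W0)); rewrite mulrBl !mulfVK ?gt_eqF// eW; ring.
rewrite mulrA ler_pdivrMr//.
have Ep : 0 < expR b + 1 by lra.
rewrite -(ler_pM2l Ep).
have := ler_wpM2r (ltW W0) (tanh_half_le b0).
by move: H; lra.
Qed.

(** * Gibbs laws and their regret at one state *)

Lemma gibbs_partition_gt0 (R : realType) (X U : finType) (rho : R)
    (H : X -> U -> R) (y : X) :
  (0 < #|U|)%N -> 0 < \sum_v expR (- rho^-1 * H y v).
Proof.
case/card_gt0P => u0 _; rewrite (bigD1 u0)//= ltr_pwDl ?expR_gt0//.
by apply: sumr_ge0 => u _; exact: expR_ge0.
Qed.

Lemma gibbs_markov (R : realType) (X U : finType) (rho : R) (H : X -> U -> R) :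
  (0 < #|U|)%N -> markov_mx (gibbs rho H).
Proof.
move=> hU y; have Z0 := gibbs_partition_gt0 rho H y hU; split.
  by move=> u; rewrite divr_ge0 ?expR_ge0// ltW.
by rewrite -mulr_suml divff// gt_eqF.
Qed.

(** Gives the first round, whose law is prescribed separately, the Gibbs form of the later ones. *)
Lemma gibbs_uniform (R : realType) (X U : finType) (rho : R) :
  gibbs rho (fun (_ : X) (_ : U) => 0) = (fun _ => @uniform_dist R U).
Proof.
apply/funext => y; apply/funext => u.
rewrite /gibbs /uniform_dist mulr0 expR0 mul1r.
by rewrite sumr_const.
Qed.

(** The exponential of a sum factors, so an update tilts the current law and renormalises: the shape
    required by [l1_tilt_le]. *)
Lemma gibbsD (R : realType) (X U : finType) (rho : R) (H h : X -> U -> R)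
    (y : X) (u : U) : (0 < #|U|)%N ->
  gibbs rho (fun y u => H y u + h y u) y u =
  gibbs rho H y u * expR (- rho^-1 * h y u) /
    \sum_v gibbs rho H y v * expR (- rho^-1 * h y v).
Proof.
move=> hU; have Z0 := gibbs_partition_gt0 rho H y hU.
have eZ : \sum_v expR (- rho^-1 * (H y v + h y v)) =
    (\sum_v gibbs rho H y v * expR (- rho^-1 * h y v)) *
    \sum_v expR (- rho^-1 * H y v).
  rewrite mulr_suml; apply: eq_bigr => v _.
  by rewrite /gibbs mulrDr expRD mulrAC mulfVK ?gt_eqF.
rewrite {1}/gibbs eZ mulrDr expRD invfM mulrA [in RHS]/gibbs -!mulrA.
by congr (_ * _); rewrite [RHS]mulrCA; congr (_ * _); rewrite mulrC.
Qed.

Lemma gibbs_step_le (R : realType) (X U : finType) (rho L : R)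
    (H h : X -> U -> R) (y : X) :
  (0 < #|U|)%N -> 0 < rho -> (forall u, `|h y u| <= L) ->
  \sum_u `|gibbs rho H y u - gibbs rho (fun y u => H y u + h y u) y u|
    <= L / rho.
Proof.
move=> hU rho0 hL.
apply: (@l1_tilt_le _ _ _ (fun u => expR (- rho^-1 * h y u))).
- exact: gibbs_markov.
- case/card_gt0P: hU => u0 _.
  by rewrite divr_ge0 ?(ltW rho0)//; apply: le_trans (hL u0).
- move=> u; have := hL u; rewrite !ler_expR ler_norml => /andP[h1 h2].
  have r0 : 0 <= rho^-1 by rewrite invr_ge0 ltW.
  have := ler_wpM2r r0 h1; have := ler_wpM2r r0 h2.
  by move=> ? ?; apply/andP; split; lra.
- by move=> u; exact: gibbsD.
Qed.

(* "Be the leader": by Jensen's inequality the partition function loses at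
   least the factor [exp (- <P_{t+1}, h_t> / rho)] in round [t]. *)
Lemma gibbs_lookahead_regret (R : realType) (X U : finType) (rho : R)
    (h H : nat -> X -> U -> R) (T : nat) (y : X) (v : U) :
  0 < rho -> (forall u, H 0%N y u = 0) ->
  (forall t u, H t.+1 y u = H t y u + h t y u) ->
  \sum_(t < T) \sum_u gibbs rho (H t.+1) y u * h t y u
    <= H T y v + rho * ln #|U|%:R.
Proof.
move=> rho0 H0 HS; have hU : (0 < #|U|)%N by apply/card_gt0P; exists v.
pose Z t := \sum_u expR (- rho^-1 * H t y u).
pose m t := \sum_u gibbs rho (H t.+1) y u * h t y u.
have step t : Z t.+1 * expR (rho^-1 * m t) <= Z t.
  have Z0 : 0 < Z t.+1 := gibbs_partition_gt0 _ _ _ hU.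
  have em : \sum_u expR (- rho^-1 * H t.+1 y u) * h t y u = Z t.+1 * m t.
    rewrite /m mulr_sumr; apply: eq_bigr => u _.
    rewrite mulrA; congr (_ * _).
    by rewrite /gibbs [RHS]mulrCA divff ?mulr1// gt_eqF.
  (* Jensen in tangent form: the tangent to the exponential at [rho^-1 * m t], averaged under the
     law of index [t.+1], returns its value at the point of tangency. *)
  have -> : Z t.+1 * expR (rho^-1 * m t) =
    \sum_u expR (- rho^-1 * H t.+1 y u) *
      (expR (rho^-1 * m t) * (1 + (rho^-1 * h t y u - rho^-1 * m t))).
    transitivity (expR (rho^-1 * m t) * (Z t.+1 * (1 - rho^-1 * m t) +
        rho^-1 * (Z t.+1 * m t))); first by ring.
    rewrite -em mulrDr /Z mulr_suml !mulr_sumr -big_split /=.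
    by apply: eq_bigr => u _; ring.
  apply: ler_sum => u _.
  have -> : H t y u = H t.+1 y u - h t y u.
    by rewrite HS addrK.
  have -> : - rho^-1 * (H t.+1 y u - h t y u) =
    - rho^-1 * H t.+1 y u + rho^-1 * h t y u by ring.
  rewrite expRD; apply: ler_wpM2l; first exact: expR_ge0.
  have {2}-> : rho^-1 * h t y u =
    rho^-1 * m t + (rho^-1 * h t y u - rho^-1 * m t) by ring.
  by rewrite expRD ler_wpM2l ?expR_ge0// expR_ge1Dx.
have tele n : Z n * expR (rho^-1 * \sum_(t < n) m t) <= #|U|%:R.
  elim: n => [|n IH].
    rewrite big_ord0 mulr0 expR0 mulr1 /Z.
    rewrite (eq_bigr (fun=> 1)) ?sumr_const// => u _.
    by rewrite H0 mulr0 expR0.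
  apply: le_trans IH; rewrite big_ord_recr/= mulrDr expRD.
  rewrite [X in Z n.+1 * X]mulrC mulrA ler_wpM2r ?expR_ge0//.
have U0 : 0 < #|U|%:R :> R by rewrite ltr0n.
(* The summand of the action [v] bounds the final partition function from below; logarithms then
   give the regret. *)
have : expR (- rho^-1 * H T y v) * expR (rho^-1 * \sum_(t < T) m t)
    <= #|U|%:R.
  apply: le_trans (tele T); rewrite ler_wpM2r ?expR_ge0// /Z (bigD1 v)//=.
  by rewrite lerDl sumr_ge0// => u _; exact: expR_ge0.
rewrite -expRD -[#|U|%:R]lnK ?posrE// ler_expR => hle.
have -> : \sum_(t < T) m t =
  H T y v + rho * (- rho^-1 * H T y v + rho^-1 * \sum_(t < T) m t).
  by field; rewrite gt_eqF.
by rewrite lerD2l ler_pM2l// expRK.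
Qed.

(** * Invariant laws: existence and stability *)

Lemma kernel_of_dist (R : realType) (X U : finType) (K : X -> U -> X -> R)
    (P : X -> U -> R) :
  is_trans_kernel K -> markov_mx P -> forall x, is_dist (kernel_of K P x).
Proof.
move=> hK hP x; split.
  by move=> y; apply: sumr_ge0 => u _; rewrite mulr_ge0 ?(hK x u).1 ?(hP x).1.
rewrite exchange_big /= -[RHS](hP x).2; apply: eq_bigr => u _.
by rewrite -mulr_suml (hK x u).2 mul1r.
Qed.

Lemma push_dist (R : realType) (X U : finType) (K : X -> U -> X -> R)
    (mu : X -> R) (P : X -> U -> R) :
  is_trans_kernel K -> is_dist mu -> markov_mx P -> is_dist (push K mu P).
Proof.
move=> hK hmu hP; have hk := kernel_of_dist hK hP; split.
  by move=> y; apply: sumr_ge0 => x _; rewrite mulr_ge0 ?hmu.1 ?(hk x).1.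
rewrite exchange_big /= -[RHS]hmu.2; apply: eq_bigr => x _.
by rewrite -mulr_sumr (hk x).2 mulr1.
Qed.

(** Constants form a right eigenvector for the eigenvalue 1, so [A - 1] is singular and has a left
    kernel as well. *)
Lemma stochastic_left_fixed (R : realType) (n : nat) (A : 'M[R]_n) :
  (0 < n)%N -> (forall i, \sum_j A i j = 1) ->
  exists2 v : 'rV[R]_n, v != 0 & v *m A = v.
Proof.
move=> n0 hA.
have : \det (A - 1%:M)^T == 0.
  apply/det0P; exists (const_mx 1).
    apply/eqP => /rowP /(_ (Ordinal n0)); rewrite !mxE => /eqP.
    by rewrite oner_eq0.
  apply/rowP => i; rewrite !mxE.
  rewrite (eq_bigr (fun j => A i j - (i == j)%:R)); last first.
    by move=> j _; rewrite !mxE mul1r.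
  rewrite sumrB hA (bigD1 i)//= eqxx big1 ?addr0 ?subrr// => j ji.
  by rewrite eq_sym (negbTE ji).
rewrite det_tr => /det0P[v v0 hv]; exists v => //.
by apply/eqP; rewrite -subr_eq0 -{2}[v]mulmx1 -mulmxBr hv.
Qed.

(* If [v] is a nonzero left eigenvector of a stochastic matrix [M] for the
   eigenvalue 1, then [|v| <= |v| M] with equal total masses, so [|v|] is
   invariant as well. *)
Lemma invariant_dist_exists (R : realType) (X U : finType)
    (K : X -> U -> X -> R) (P : X -> U -> R) :
  (0 < #|X|)%N -> is_trans_kernel K -> markov_mx P ->
  exists mu, invariant_dist K P mu.
Proof.
move=> hX hK hP; have hk := kernel_of_dist hK hP.
have sumE (g : X -> R) : \sum_x g x = \sum_(i < #|X|) g (enum_val i).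
  by rewrite -(big_enum_val (A := X)).
have [v v0 hv] : exists2 v : X -> R, (exists x, v x != 0) &
    forall y, \sum_x v x * kernel_of K P x y = v y.
  pose A : 'M[R]_#|X| :=
    \matrix_(i, j) kernel_of K P (enum_val i) (enum_val j).
  have [|v vn0 hv] := @stochastic_left_fixed R _ A hX.
    move=> i; rewrite -[RHS](hk (enum_val i)).2 sumE.
    by apply: eq_bigr => j _; rewrite mxE.
  exists (fun x => v ord0 (enum_rank x)).
    by move/rV0Pn: vn0 => [i vi]; exists (enum_val i); rewrite enum_valK.
  move=> y; rewrite -[in RHS]hv mxE sumE; apply: eq_bigr => i _.
  by rewrite mxE enum_valK enum_rankK.
have le_abs y : `|v y| <= \sum_x `|v x| * kernel_of K P x y.
  rewrite -hv; apply: le_trans (ler_norm_sum _ _ _) _; apply: ler_sum => x _.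
  by rewrite normrM (ger0_norm ((hk x).1 y)).
have abs_fix y : \sum_x `|v x| * kernel_of K P x y = `|v y|.
  have s0 : \sum_y (\sum_x `|v x| * kernel_of K P x y - `|v y|) = 0.
    rewrite sumrB exchange_big /=; apply/eqP; rewrite subr_eq0; apply/eqP.
    by apply: eq_bigr => x _; rewrite -mulr_sumr (hk x).2 mulr1.
  apply/eqP; rewrite -subr_eq0; apply/eqP; move/eqP: s0.
  rewrite psumr_eq0; last by move=> z _; rewrite subr_ge0.
  by move=> /allP /(_ y (mem_index_enum _)) /eqP.
set S := \sum_x `|v x|.
have S0 : 0 < S.
  case: v0 => x vx; rewrite /S (bigD1 x)//= ltr_pwDl ?normr_gt0//.
  by apply: sumr_ge0.
exists (fun x => `|v x| / S); split; first split.
- by move=> x; rewrite divr_ge0// ltW.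
- by rewrite -mulr_suml divff// gt_eqF.
- apply/funext => y; rewrite /push -abs_fix mulr_suml.
  by apply: eq_bigr => x _; rewrite mulrAC.
Qed.

Lemma inv_dist_invariant (R : realType) (X U : finType)
    (K : X -> U -> X -> R) (P : X -> U -> R) :
  (0 < #|X|)%N -> is_trans_kernel K -> markov_mx P ->
  invariant_dist K P (inv_dist K P).
Proof.
by move=> hX hK hP; apply: xgetPex; exact: invariant_dist_exists.
Qed.

Lemma push_perturb_le (R : realType) (X U : finType) (K : X -> U -> X -> R)
    (mu : X -> R) (P P' : X -> U -> R) (d : R) :
  is_trans_kernel K -> is_dist mu ->
  (forall x, \sum_u `|P x u - P' x u| <= d) ->
  l1_norm (fun y => push K mu P y - push K mu P' y) <= d.
Proof.
move=> hK hmu hd; rewrite /l1_norm.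
apply: (@le_trans _ _ (\sum_y \sum_x \sum_u
    mu x * (K x u y * `|P x u - P' x u|))).
  apply: ler_sum => y _; rewrite /push -sumrB.
  apply: le_trans (ler_norm_sum _ _ _) _; apply: ler_sum => x _.
  rewrite -mulrBr normrM (ger0_norm (hmu.1 x)) -mulr_sumr.
  apply: ler_wpM2l; first exact: hmu.1.
  rewrite /kernel_of -sumrB; apply: le_trans (ler_norm_sum _ _ _) _.
  apply: ler_sum => u _.
  by rewrite -mulrBr normrM (ger0_norm ((hK x u).1 y)).
rewrite exchange_big /= -[leRHS]mul1r -hmu.2 mulr_suml.
apply: ler_sum => x _; rewrite exchange_big /=.
rewrite (eq_bigr (fun u => mu x * `|P x u - P' x u|)); last first.
  by move=> u _; rewrite -mulr_sumr -mulr_suml (hK x u).2 mul1r.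
by rewrite -mulr_sumr; apply: ler_wpM2l; [exact: hmu.1|exact: hd].
Qed.

Lemma l1_dist_triangle (R : realType) (I : finType) (p q r : I -> R) :
  l1_norm (fun i => p i - r i) <=
  l1_norm (fun i => p i - q i) + l1_norm (fun i => q i - r i).
Proof.
rewrite /l1_norm -big_split; apply: ler_sum => i _ /=.
by apply: le_trans (ler_normD _ _); rewrite addrA subrK.
Qed.

Lemma l1_dist_le2 (R : realType) (I : finType) (p q : I -> R) :
  is_dist p -> is_dist q -> l1_norm (fun i => p i - q i) <= 2.
Proof.
move=> hp hq; have -> : 2 = \sum_i (p i + q i) :> R.
  by rewrite big_split /= hp.2 hq.2.
apply: ler_sum => i _; apply: le_trans (ler_normB _ _) _.
by rewrite !ger0_norm ?hp.1 ?hq.1.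
Qed.

(** Follows from 1 + 1 / tau <= e^(1 / tau). The contraction factor is then at most tau / (tau + 1),
    at distance 1 / (tau + 1) from 1: the source of the factors [tau + 1] below. *)
Lemma expR_Ninv_le (R : realType) (tau : R) : 1 <= tau ->
  expR (- tau^-1) * (tau + 1) <= tau.
Proof.
move=> t1; have t0 : 0 < tau by lra.
have := expR_ge1Dx tau^-1; rewrite expRN => h.
rewrite mulrC ler_pdivrMr ?expR_gt0//.
have -> : tau + 1 = tau * (1 + tau^-1) by rewrite mulrDr divff ?gt_eqF// mulr1.
by rewrite ler_pM2l.
Qed.

(** Both laws are fixed points. Going through the push of [inv_dist K P] under [P'] gives N <= d +
    e^(-1 / tau) N, which is solved for N. *)
Lemma inv_dist_perturb_le (R : realType) (X U : finType)
    (K : X -> U -> X -> R) (tau d : R) (P P' : X -> U -> R) :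
  (0 < #|X|)%N -> is_trans_kernel K -> uniform_mixing K tau ->
  markov_mx P -> markov_mx P' ->
  (forall x, \sum_u `|P x u - P' x u| <= d) ->
  l1_norm (fun x => inv_dist K P x - inv_dist K P' x) <= (tau + 1) * d.
Proof.
move=> hX hK [t1 hmix] hP hP' hd.
have [di ei] := inv_dist_invariant hX hK hP.
have [di' ei'] := inv_dist_invariant hX hK hP'.
set N := l1_norm _.
have h : N <= d + expR (- tau^-1) * N.
  rewrite {1}/N -{1}ei -{1}ei'.
  apply: le_trans (l1_dist_triangle _ (push K (inv_dist K P) P') _) _.
  by apply: lerD; [exact: push_perturb_le|exact: hmix].
have N0 : 0 <= N by apply: sumr_ge0.
have := ler_wpM2r N0 (expR_Ninv_le t1).
have t2 : 0 <= tau + 1 by lra.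
by have := ler_wpM2l t2 h; lra.
Qed.

(** A potential argument in place of a geometric series: the partial sum plus [(tau + 1) * d T]
    grows by at most [(tau + 1) * c] per step. *)
Lemma contraction_sum_le (R : realType) (d : nat -> R) (tau c : R) (T : nat) :
  0 <= tau -> 0 <= d T ->
  (forall t, (tau + 1) * d t.+1 <= tau * d t + (tau + 1) * c) ->
  \sum_(t < T) d t <= (tau + 1) * (d 0%N + T%:R * c).
Proof.
move=> t0 dT hd.
suff : \sum_(t < T) d t + (tau + 1) * d T <= (tau + 1) * (d 0%N + T%:R * c).
  by have : 0 <= (tau + 1) * d T; [apply: mulr_ge0; lra|move=> *; lra].
move: {dT} T; elim => [|T IH]; first by rewrite big_ord0 mul0r addr0 add0r.
rewrite big_ord_recr/= -natr1; have := hd T; lra.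
Qed.

(** * State laws and expectations over trajectories *)

Fixpoint state_law (R : realType) (X U : finType) (K : X -> U -> X -> R)
    (P : nat -> X -> U -> R) (mu : X -> R) (t : nat) : X -> R :=
  if t is t'.+1 then push K (state_law K P mu t') (P t') else mu.

Lemma state_law_dist (R : realType) (X U : finType) (K : X -> U -> X -> R)
    (P : nat -> X -> U -> R) (mu : X -> R) (t : nat) :
  is_trans_kernel K -> (forall t, markov_mx (P t)) -> is_dist mu ->
  is_dist (state_law K P mu t).
Proof. by move=> hK hP hmu; elim: t => //= t IH; exact: push_dist. Qed.

(** Peels off the first round instead of the last, to match the recursion of [traj_prob]. *)
Lemma state_law_shift (R : realType) (X U : finType) (K : X -> U -> X -> R)
    (P : nat -> X -> U -> R) (mu : X -> R) (t : nat) :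
  state_law K P mu t.+1 =
  state_law K (fun s => P s.+1) (push K mu (P 0%N)) t.
Proof. by elim: t => //= t <-. Qed.

Lemma state_law_mixture (R : realType) (X U I : finType)
    (K : X -> U -> X -> R) (P : nat -> X -> U -> R) (c : I -> R)
    (m : I -> X -> R) (t : nat) (x : X) :
  \sum_i c i * state_law K P (m i) t x =
  state_law K P (fun y => \sum_i c i * m i y) t x.
Proof.
elim: t x => //= t IH x; rewrite /push.
under eq_bigr do rewrite mulr_sumr.
rewrite exchange_big /=; apply: eq_bigr => y _.
by rewrite -IH mulr_suml; apply: eq_bigr => i _; rewrite mulrA.
Qed.

Lemma push_mixture (R : realType) (X U : finType) (K : X -> U -> X -> R)
    (mu : X -> R) (P : X -> U -> R) :
  push K mu P = fun y => \sum_(z : X * U) mu z.1 * P z.1 z.2 * K z.1 z.2 y.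
Proof.
apply/funext => y; rewrite /push /kernel_of.
rewrite -(pair_bigA _ (fun x u => mu x * P x u * K x u y)) /=.
apply: eq_bigr => x _; rewrite mulr_sumr; apply: eq_bigr => u _; ring.
Qed.

Lemma sum_tuple_cons (R : realType) (I : finType) (n : nat)
    (F : n.+1.-tuple I -> R) :
  \sum_w F w = \sum_i \sum_(w : n.-tuple I) F [tuple of i :: w].
Proof.
rewrite pair_bigA /=.
rewrite (reindex (fun z : I * n.-tuple I => [tuple of z.1 :: z.2])) //=.
exists (fun w => (thead w, [tuple of behead w])).
  by move=> [i w] _ /=; congr (_, _); apply: val_inj.
by move=> w _; rewrite [w in RHS]tuple_eta; apply: val_inj.
Qed.

(** Lets the laws of the game, computed from finite prefixes of costs, be replaced by a sequence
    indexed by all rounds. *)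
Lemma eq_traj_prob (R : realType) (X U : finType) (K : X -> U -> X -> R)
    (P P' : nat -> X -> U -> R) (mu : X -> R) (w : seq (X * U)) :
  (forall t, (t < size w)%N -> P t = P' t) ->
  traj_prob K P mu w = traj_prob K P' mu w.
Proof.
elim: w P P' mu => [//|[y u] w IH] P P' mu h /=.
by rewrite h// (IH _ (fun t => P' t.+1))// => t tw; apply: h.
Qed.

Lemma traj_prob_sum1 (R : realType) (X U : finType) (K : X -> U -> X -> R)
    (P : nat -> X -> U -> R) (mu : X -> R) (n : nat) :
  is_trans_kernel K -> (forall t, markov_mx (P t)) -> is_dist mu ->
  \sum_(w : n.-tuple (X * U)) traj_prob K P mu w = 1.
Proof.
move=> hK; elim: n P mu => [|n IH] P mu hP hmu.
  rewrite (bigD1 [tuple]) //= big1 ?addr0// => w /negP[].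
  by apply/eqP; exact: tuple0.
rewrite sum_tuple_cons.
transitivity (\sum_y \sum_u \sum_(w : n.-tuple (X * U))
  traj_prob K P mu ((y, u) :: w)).
  by rewrite [RHS]pair_bigA; apply: eq_bigr => -[y u] _.
rewrite -[RHS]hmu.2; apply: eq_bigr => y _.
rewrite -[RHS]mulr1 -(hP 0%N y).2 mulr_sumr; apply: eq_bigr => u _.
by rewrite -mulr_sumr IH ?mulr1.
Qed.

(** Induction by conditioning on the first pair [z]: the rest is a game started from [K z.1 z.2],
    and since state laws are linear in the initial law, mixing over [z] restores the law of the
    state. *)
Lemma traj_prob_cost (R : realType) (X U : finType) (K : X -> U -> X -> R)
    (P : nat -> X -> U -> R) (mu : X -> R) (g : nat -> X -> U -> R) (n : nat) :
  is_trans_kernel K -> (forall t, markov_mx (P t)) -> is_dist mu ->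
  \sum_(w : n.-tuple (X * U))
     traj_prob K P mu w * \sum_(t < n) g t (tnth w t).1 (tnth w t).2
  = \sum_(t < n) pairing (otimes (state_law K P mu t) (P t)) (g t).
Proof.
move=> hK; elim: n P mu g => [|n IH] P mu g hP hmu.
  by rewrite big_ord0 big1// => w _; rewrite big_ord0 mulr0.
rewrite sum_tuple_cons.
transitivity (\sum_(z : X * U) mu z.1 * P 0%N z.1 z.2 * (g 0%N z.1 z.2 +
  \sum_(t < n) pairing (otimes (state_law K (fun s => P s.+1) (K z.1 z.2) t)
     (P t.+1)) (g t.+1))).
  apply: eq_bigr => -[y u] _ /=; have hKu : is_dist (K y u) by [].
  rewrite -(IH _ _ (fun t => g t.+1))// -[g 0%N y u]mulr1.
  (* The first cost is spread over the continuations, whose total mass is 1, to join the sum over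
     [w]. *)
  rewrite -(@traj_prob_sum1 _ _ _ K (fun s => P s.+1) (K y u) n)//.
  rewrite mulr_sumr -big_split /= mulr_sumr; apply: eq_bigr => w _.
  rewrite big_ord_recl (tnth0 (y, u) w) /=.
  under eq_bigr do rewrite (tnthS (y, u) w).
  by ring.
under eq_bigr do rewrite mulrDr.
rewrite big_split big_ord_recl /=; congr (_ + _).
  by rewrite /pairing /otimes pair_bigA.
under eq_bigr do rewrite mulr_sumr.
rewrite exchange_big /=; apply: eq_bigr => t _.
rewrite -[push K _ _]/(state_law K P mu t.+1) state_law_shift.
rewrite push_mixture /pairing /otimes.
under eq_bigr do rewrite mulr_sumr.
rewrite exchange_big /=; apply: eq_bigr => x _.
rewrite -state_law_mixture.
under [in RHS]eq_bigr do rewrite !mulr_suml.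
rewrite exchange_big /=; apply: eq_bigr => z _.
by rewrite mulr_sumr; apply: eq_bigr => u _; rewrite !mulrA.
Qed.

(** * Tracking the invariant laws, and steady-state regret *)

Lemma pairing_law_diff_le (R : realType) (X U : finType) (mu mu' : X -> R)
    (P g : X -> U -> R) (C : R) :
  markov_mx P -> (forall x u, `|g x u| <= C) ->
  pairing (otimes mu P) g - pairing (otimes mu' P) g
    <= C * l1_norm (fun x => mu x - mu' x).
Proof.
move=> hP hg; rewrite /pairing /otimes -sumrB /l1_norm mulr_sumr.
apply: ler_sum => x _; rewrite -sumrB.
have -> : C * `|mu x - mu' x| = \sum_u P x u * (C * `|mu x - mu' x|).
  by rewrite -mulr_suml (hP x).2 mul1r.
apply: ler_sum => u _.
have -> : mu x * P x u * g x u - mu' x * P x u * g x u =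
  P x u * (g x u * (mu x - mu' x)) by ring.
apply: ler_wpM2l; first exact: (hP x).1.
by apply: le_trans (ler_norm _) _; rewrite normrM ler_wpM2r.
Qed.

Lemma slowly_varying_cost_le (R : realType) (X U : finType)
    (K : X -> U -> X -> R) (tau C d : R) (P g : nat -> X -> U -> R)
    (mu : X -> R) (T : nat) :
  (0 < #|X|)%N -> is_trans_kernel K -> uniform_mixing K tau ->
  (forall t, markov_mx (P t)) -> is_dist mu ->
  0 <= C -> (forall t x u, `|g t x u| <= C) ->
  (forall t x, \sum_u `|P t x u - P t.+1 x u| <= d) ->
  \sum_(t < T) pairing (otimes (state_law K P mu t) (P t)) (g t) -
  \sum_(t < T) pairing (otimes (inv_dist K (P t)) (P t)) (g t)
    <= C * ((tau + 1) * (2 + T%:R * ((tau + 1) * d))).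
Proof.
move=> hX hK hmix hP hmu C0 hg hd; have [t1 hm] := hmix.
pose e t := l1_norm (fun x => state_law K P mu t x - inv_dist K (P t) x).
have e0 t : 0 <= e t by apply: sumr_ge0.
have [ds di] : (forall t, is_dist (state_law K P mu t)) /\
    (forall t, is_dist (inv_dist K (P t))).
  split=> t; first exact: state_law_dist.
  by have [] := inv_dist_invariant hX hK (hP t).
(* A round under [P t] contracts the gap to the invariant law of [P t]; that law then moves by at
   most [(tau + 1) * d]. *)
have estep t : (tau + 1) * e t.+1 <= tau * e t + (tau + 1) * ((tau + 1) * d).
  have h : e t.+1 <= expR (- tau^-1) * e t + (tau + 1) * d.
    apply: le_trans (l1_dist_triangle _ (inv_dist K (P t)) _) _.
    apply: lerD; last by apply: inv_dist_perturb_le.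
    have [_ {1}<-] := inv_dist_invariant hX hK (hP t).
    exact: hm.
  have t2 : 0 <= tau + 1 by lra.
  have := ler_wpM2l t2 h; have := ler_wpM2r (e0 t) (expR_Ninv_le t1).
  by move=> *; lra.
rewrite -sumrB; apply: (@le_trans _ _ (\sum_(t < T) C * e t)).
  by apply: ler_sum => t _; apply: pairing_law_diff_le.
rewrite -mulr_sumr; apply: ler_wpM2l => //.
have t0 : 0 <= tau by lra.
apply: le_trans (contraction_sum_le t0 (e0 T) estep) _.
apply: ler_wpM2l; first lra.
(* The initial gap is at most 2 for any starting law; this yields the term of the bound that does
   not grow with [T]. *)
by rewrite lerD2r; apply: l1_dist_le2.
Qed.

(* Averaging the reverse Poisson inequality over [pi_P' (x) P'] turns the gap
   between steady-state costs into a gap between one-shot costs [q]. *)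
Lemma reverse_Poisson_gap (R : realType) (X U : finType)
    (K : X -> U -> X -> R) (P P' g q : X -> U -> R) :
  (0 < #|X|)%N -> is_trans_kernel K -> markov_mx P' ->
  reverse_Poisson K P g q ->
  pairing (otimes (inv_dist K P) P) g - pairing (otimes (inv_dist K P') P') g
  <= \sum_y inv_dist K P' y *
       (\sum_u P y u * q y u - \sum_u P' y u * q y u).
Proof.
move=> hX hK hP' hq; have [di ei] := inv_dist_invariant hX hK hP'.
set c := pairing (otimes (inv_dist K P) P) g; set nu := inv_dist K P' in di ei *.
pose V y := \sum_u P y u * q y u.
(* Invariance of [nu] replaces the average of [V] over the current state by its average over the
   next one, which is the kernel term of the reverse Poisson inequality. *)
have nuV : \sum_y nu y * V y =
    \sum_x \sum_u nu x * P' x u * \sum_y K x u y * V y.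
  rewrite -{1}ei push_mixture; under eq_bigr do rewrite mulr_suml.
  rewrite exchange_big [RHS]pair_bigA; apply: eq_bigr => z _ /=.
  by rewrite mulr_sumr; apply: eq_bigr => y _; rewrite mulrA.
have sum1 : \sum_x \sum_u nu x * P' x u = 1.
  by rewrite -di.2; apply: eq_bigr => x _; rewrite -mulr_sumr (hP' x).2 mulr1.
have -> : \sum_y nu y * (\sum_u P y u * q y u - \sum_u P' y u * q y u) =
    \sum_x \sum_u nu x * P' x u * (\sum_y K x u y * V y - q x u).
  transitivity (\sum_y nu y * V y - \sum_y nu y * \sum_u P' y u * q y u).
    by rewrite -sumrB; apply: eq_bigr => y _; rewrite mulrBr.
  rewrite nuV -sumrB; apply: eq_bigr => x _.
  rewrite mulr_sumr -sumrB; apply: eq_bigr => u _; ring.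
rewrite lerBlDr -[c]mul1r -sum1 mulr_suml /pairing /otimes -big_split /=.
apply: ler_sum => x _; rewrite mulr_suml -big_split /=.
apply: ler_sum => u _; rewrite -mulrDr; apply: ler_wpM2l.
  by rewrite mulr_ge0 ?di.1 ?(hP' x).1.
by have := hq x u; rewrite -/c -/(V _); lra.
Qed.

(** The averaging weights [nu] belong to the comparator and are the same in all rounds, so sums over
    rounds and states may be exchanged and a bound at each state suffices. *)
Lemma exp_weights_steady_regret (R : realType) (X U : finType)
    (K : X -> U -> X -> R) (rho L : R) (g h H : nat -> X -> U -> R)
    (P' : X -> U -> R) (T : nat) :
  let P t := gibbs rho (H t) in
  (0 < #|X|)%N -> (0 < #|U|)%N -> is_trans_kernel K -> markov_mx P' ->
  (0 < rho) -> (forall t y u, `|h t y u| <= L) ->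
  (forall y u, H 0%N y u = 0) ->
  (forall t, H t.+1 = fun y u => H t y u + h t y u) ->
  (forall t, reverse_Poisson K (P t) (g t) (h t)) ->
  \sum_(t < T) pairing (otimes (inv_dist K (P t)) (P t)) (g t) -
  \sum_(t < T) pairing (otimes (inv_dist K P') P') (g t)
    <= rho * ln #|U|%:R + T%:R * (L * (L / rho)).
Proof.
move=> P hX hU hK hP' rho0 hL H0 HS hq; set B := (X in _ <= X).
have [di _] := inv_dist_invariant hX hK hP'.
set nu := inv_dist K P' in di *.
have key y : \sum_(t < T) (\sum_u P t y u * h t y u -
    \sum_u P' y u * h t y u) <= B.
  have lookahead : \sum_(t < T) \sum_u P t.+1 y u * h t y u <=
      \sum_(t < T) \sum_u P' y u * h t y u + rho * ln #|U|%:R.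
    have -> : \sum_(t < T) \sum_u P' y u * h t y u = \sum_u P' y u * H T y u.
      rewrite exchange_big /=; apply: eq_bigr => u _; rewrite -mulr_sumr.
      congr (_ * _); elim: T {B} => [|n IH]; first by rewrite big_ord0 H0.
      by rewrite big_ord_recr/= IH HS.
    set M := rho * _.
    (* [P' y] is a mixture of pure actions [v], against each of which the lookahead bound holds. *)
    rewrite -[leLHS]mul1r -[M]mul1r -(hP' y).2 !mulr_suml -big_split.
    apply: ler_sum => v _ /=; rewrite -mulrDr; apply: ler_wpM2l.
      exact: (hP' y).1.
    by apply: gibbs_lookahead_regret => // t u; rewrite HS.
  have drift : \sum_(t < T) \sum_u P t y u * h t y u -
      \sum_(t < T) \sum_u P t.+1 y u * h t y u <= T%:R * (L * (L / rho)).
    rewrite -sumrB -[T in leRHS]card_ord -sum1_card natr_sum mulr_suml.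
    apply: ler_sum => t _; rewrite mul1r -sumrB.
    have L0 : 0 <= L.
      by case/card_gt0P: hU => u0 _; apply: le_trans (hL t y u0).
    apply: (@le_trans _ _ (\sum_u L * `|P t y u - P t.+1 y u|)).
      apply: ler_sum => u _; rewrite -mulrBl.
      by apply: le_trans (ler_norm _) _; rewrite normrM mulrC ler_wpM2r.
    rewrite -mulr_sumr; apply: ler_wpM2l => //.
    by rewrite /P HS; apply: gibbs_step_le.
  by rewrite sumrB /B; lra.
rewrite -sumrB; apply: (@le_trans _ _ (\sum_(t < T) \sum_y nu y *
    (\sum_u P t y u * h t y u - \sum_u P' y u * h t y u))).
  by apply: ler_sum => t _; apply: reverse_Poisson_gap.
rewrite exchange_big /= -[B]mul1r -di.2 mulr_suml; apply: ler_sum => y _.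
by rewrite -mulr_sumr; apply: ler_wpM2l; [exact: di.1|exact: key].
Qed.

(** * Suprema over the cost class, and the regret bound *)

Lemma le_sup_norm (R : realType) (X U : finType) (g : X -> U -> R) x u :
  `|g x u| <= sup_norm g.
Proof. exact: (le_bigmax 0 (fun z : X * U => `|g z.1 z.2|) (x, u)). Qed.

Lemma le_Q_sup (R : realType) (X U : finType) (F : set (X -> U -> R))
    (Q : (X -> U -> R) -> (X -> U -> R) -> X -> U -> R) (P f : X -> U -> R)
    (x : X) (u : U) :
  Q_sup F Q \is a fin_num -> markov_mx P -> F f ->
  `|Q P f x u| <= fine (Q_sup F Q).
Proof.
move=> hfin hP hf; apply: le_trans (le_sup_norm _ x u) _.
rewrite -lee_fin fineK//.
apply: le_trans (ereal_sup_ubound _); last by exists P.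
by apply: ereal_sup_ubound; exists f.
Qed.

Lemma le_cost_sup (R : realType) (X U : finType) (F : set (X -> U -> R))
    (f : X -> U -> R) (x : X) (u : U) :
  uniformly_bounded F -> F f -> `|f x u| <= fine (cost_sup F).
Proof.
move=> [B hB] hf; apply: le_trans (le_sup_norm _ x u) _.
have hle : ((sup_norm f)%:E <= cost_sup F)%E.
  by apply: ereal_sup_ubound; exists f.
(* The maximum with 0 accounts for the base value of the maximum in [sup_norm]. *)
have hge : (cost_sup F <= (Num.max 0 B)%:E)%E.
  apply: ge_ereal_sup => _ [g hg <-]; rewrite lee_fin.
  apply: bigmax_le => [|z _]; first by rewrite le_max lexx.
  by rewrite le_max hB ?orbT.
rewrite -lee_fin fineK// fin_numElt.
by rewrite (lt_le_trans (ltNyr _) hle) (le_lt_trans hge (ltry _)).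
Qed.

Theorem theorem3 (R : realType) (X U : finType) (K : X -> U -> X -> R)
    (F : set (X -> U -> R))
    (Q : (X -> U -> R) -> (X -> U -> R) -> X -> U -> R)
    (T : nat) (tau : R)
    (hX : (0 < #|X|)%N) (hU : (2 <= #|U|)%N) (hT : (1 <= T)%N)
    (hK : is_trans_kernel K) (hmix : uniform_mixing K tau)
    (hF0 : F !=set0) (hFb : uniformly_bounded F)
    (hQ : forall P f, markov_mx P -> F f -> reverse_Poisson K P f (Q P f))
    (hQfin : (Q_sup F Q < +oo)%E) :
  let L : R := fine (Q_sup F Q) in
  let CF : R := fine (cost_sup F) in
  let rho : R := Num.sqrt (2 * T%:R * L ^+ 2 / ln #|U|%:R) in
  0 < L ->
  forall (x : X) (f : T.-tuple (X -> U -> R)),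
    (forall t : 'I_T, F (tnth f t)) ->
    game_expectation K (exp_weights Q rho) f x
      (fun w : T.-tuple (X * U) =>
         \sum_(t < T) tnth f t (tnth w t).1 (tnth w t).2 - comparator K f)
    <= 2 * L * Num.sqrt (2 * T%:R * ln #|U|%:R)
       + CF * (tau + 1) ^+ 2 * Num.sqrt (T%:R * ln #|U|%:R / 2)
       + (2 * tau + 2) * CF.
Proof.
move=> L CF rho L0 x f hf.
have U0 : (0 < #|U|)%N by apply: ltnW.
(* [fine] is 0 at infinite values, so [0 < L] excludes [-oo]; [hQfin] excludes [+oo]. *)
have Qfin : Q_sup F Q \is a fin_num.
  by move: L0 hQfin; rewrite /L; case: (Q_sup F Q) => //=; rewrite ltxx.
set l : R := ln #|U|%:R; set s := Num.sqrt (2 * T%:R * l).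
have l0 : 0 < l by rewrite ln_gt0// ltr1n.
have T0 : 0 < T%:R :> R by rewrite ltr0n.
have s0 : 0 < s by rewrite sqrtr_gt0 !mulr_gt0.
have s2 : s ^+ 2 = 2 * T%:R * l by rewrite sqr_sqrtr// ltW// !mulr_gt0.
(* All square roots are expressed through [s], which makes the final comparison algebraic. *)
have rhoE : rho = L * s / l.
  rewrite -[RHS]ger0_norm; last by rewrite !mulr_ge0 ?invr_ge0 ?ltW.
  rewrite -sqrtr_sqr !exprMn s2 /rho -/l; congr Num.sqrt.
  by field; rewrite gt_eqF.
have rho0 : 0 < rho by rewrite rhoE divr_gt0// mulr_gt0.
have sqrt_half : Num.sqrt (T%:R * l / 2) = s / 2.
  rewrite -[RHS]ger0_norm; last by rewrite divr_ge0 ?ltW.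
  by rewrite -sqrtr_sqr exprMn s2; congr Num.sqrt; field.
have [f0 Ff0] := hF0.
(* Beyond the horizon the costs are continued by a member of [F], so the per-round hypotheses hold
   for every [t]. *)
pose g t := nth f0 f t.
have Fg t : F (g t).
  have [tT|tT] := ltnP t T; last by rewrite /g nth_default// size_tuple.
  by have := hf (Ordinal tT); rewrite (tnth_nth f0).
pose H t := (exp_weights_state Q rho (mkseq g t)).2.
pose h t := Q (exp_weights_state Q rho (mkseq g t)).1 (g t).
pose P t := gibbs rho (H t).
have PE t : exp_weights Q rho (mkseq g t) = P t.
  rewrite /exp_weights /P /H; case: t => [|t]; first by rewrite /= gibbs_uniform.
  by rewrite mkseqS /exp_weights_state -cats1 foldl_cat.
have HS t : H t.+1 = fun y u => H t y u + h t y u.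
  by rewrite /H mkseqS /exp_weights_state -cats1 foldl_cat.
have hP t : markov_mx (P t) by apply: gibbs_markov.
have hE t : h t = Q (P t) (g t) by rewrite -PE.
have hL t y u : `|h t y u| <= L by rewrite hE; apply: le_Q_sup.
have hC t y u : `|g t y u| <= CF by apply: le_cost_sup.
have C0 : 0 <= CF.
  by case/card_gt0P: U0 => u _; apply: le_trans (hC 0%N x u).
have hx : is_dist (@dirac_dist R X x).
  split=> [z|]; first exact: ler0n.
  rewrite (bigD1 x)//= big1 ?addr0 /dirac_dist ?eqxx// => z /negbTE -> //.
pose cost := \sum_(t < T)
  pairing (otimes (state_law K P (dirac_dist R x) t) (P t)) (g t).
have -> : game_expectation K (exp_weights Q rho) f x
      (fun w : T.-tuple (X * U) =>
         \sum_(t < T) tnth f t (tnth w t).1 (tnth w t).2 - comparator K f) =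
    cost - comparator K f.
  rewrite /cost -traj_prob_cost// -[X in _ = _ - X]mul1r.
  (* The comparator is constant over trajectories, whose total mass is 1. *)
  rewrite -(@traj_prob_sum1 _ _ _ K P (dirac_dist R x) T)// mulr_suml -sumrB.
  apply: eq_bigr => w _; rewrite -mulrBr.
  congr (_ * (_ - _)).
    apply: eq_traj_prob => t; rewrite size_tuple => tT.
    rewrite -PE; congr (exp_weights Q rho _).
    have tf : (t <= size f)%N by rewrite size_tuple ltnW.
    apply: (@eq_from_nth _ f0); first by rewrite size_mkseq size_takel.
    by move=> i; rewrite size_takel// => it; rewrite nth_take// nth_mkseq.
  by apply: eq_bigr => t _; rewrite (tnth_nth f0).
have Pstep t y : \sum_u `|P t y u - P t.+1 y u| <= L / rho.
  by rewrite /P HS; apply: gibbs_step_le.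
have drift := slowly_varying_cost_le T hX hK hmix hP hx C0 hC Pstep.
pose steady := \sum_(t < T) pairing (otimes (inv_dist K (P t)) (P t)) (g t).
have regret : steady - (rho * l + T%:R * (L * (L / rho))) <= comparator K f.
  (* The infimum need not be attained: the regret bound holds against every [P'], and [P 0] shows
     that the set is nonempty. *)
  apply: lb_le_inf.
    by eexists; exists (P 0%N).
  move=> _ [P' hP' <-]; rewrite big_tuple.
  rewrite (eq_bigr _ (fun t _ => congr1 _ (tnth_nth f0 f t))).
  rewrite lerBlDr -lerBlDl; apply: (exp_weights_steady_regret (h := h)) => //.
  by move=> t; rewrite hE; exact: hQ (hP t) (Fg t).
have rl : rho * l = L * s by rewrite rhoE mulfVK// gt_eqF.
(* This [rho] makes the summed bounds on the l1 steps of the law equal to [s / 2]. *)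
have TLr : T%:R * (L / rho) = s / 2.
  have -> : T%:R = s ^+ 2 / (2 * l) by rewrite s2; field; rewrite gt_eqF.
  by rewrite rhoE; field; rewrite !gt_eqF.
have TLLr : T%:R * (L * (L / rho)) = L * (s / 2) by rewrite -TLr; ring.
have drift_bound : CF * ((tau + 1) * (2 + T%:R * ((tau + 1) * (L / rho)))) =
    CF * (tau + 1) ^+ 2 * (s / 2) + (2 * tau + 2) * CF by rewrite -TLr; ring.
(* The steady-state regret totals 3/2 of [L * s], so the sign of [L * s] gives the stated factor
   2. *)
have Ls : 0 <= L * s by rewrite ltW// mulr_gt0.
rewrite drift_bound -/cost -/steady in drift; rewrite rl TLLr in regret.
by rewrite sqrt_half; lra.
Qed.
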